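(* There exists a universal constant $K>0$ such that for every $0<\beta<\alpha$ and every bounded Ahlfors $\alpha$-regular metric space $(X,d)$, there is a compact subset $Y\subseteq X$ such that $(Y,d|_Y)$ is Ahlfors $\beta$-regular and the ultrametric distortion of $Y$ is at most $K\,\alpha/(\alpha-\beta)$.
   Context: For a metric space $(X,d)$, $x\in X$, $r\ge 0$, $B_d(x,r)=\{y\in X: d(x,y)\le r\}$ is the closed ball. A complete metric space $(X,d)$ is called Ahlfors $\alpha$-regular ($\alpha$-regular for short), $\alpha>0$, if there exist a Borel measure $\mu$ on $X$ and constants $C\ge c>0$ such that $c r^\alpha\le \mu(B_d(x,r))\le C r^\alpha$ for all $x\in X$ and $r\in(0,\operatorname{diam}(X))$. In particular such a space has Hausdorff dimension $\alpha$; accordingly, empty and one-point spaces (diameter zero), for which the inequalities would be vacuous, are not regarded as $\alpha$-regular. An ultrametric on a set $U$ is a metric $\rho$ satisfying $\rho(x,y)\le\max\{\rho(x,z),\rho(y,z)\}$ for all $x,y,z\in U$. A metric space $(Y,d)$ embeds with distortion $D\in[1,\infty)$ into an ultrametric space if there exists an ultrametric $\rho$ on $Y$ with $d(x,y)\le\rho(x,y)\le D\,d(x,y)$ for all $x,y\in Y$. The ultrametric distortion of $Y$ is the infimum of all $D$ for which $Y$ embeds in an ultrametric with distortion at most $D$. A subset $Y\subseteq X$ carries the restricted metric $d|_Y$. *)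

(* Defs.v *)
From HB Require Import structures.
From mathcomp Require Import all_boot all_order all_algebra.
From mathcomp Require Import all_classical all_reals all_analysis.

Set Implicit Arguments.
Unset Strict Implicit.
Unset Printing Implicit Defensive.

Import Order.TTheory GRing.Theory Num.Theory.

Local Open Scope classical_set_scope.
Local Open Scope ring_scope.

(* The library gives [set_type A] the induced topology, uniformity and balls;
   this adds the restricted distance. *)
Section restricted_metric.
Context {R : realType} {X : metricType R} (A : set X).

Let rdist (x y : set_type A) : R := mdist (set_val x) (set_val y).

Let rdist_ge0 x y : 0 <= rdist x y.
Proof. exact: mdist_ge0. Qed.

Let rdist_positivity x y : rdist x y = 0 -> x = y.
Proof. by move=> /mdist_positivity; exact: val_inj. Qed.

Let ballErdist x d : ball x d = [set y | rdist x y < d].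
Proof. by rewrite -initial_ballE ballEmdist. Qed.

HB.instance Definition _ := PseudoMetric_isMetric.Build R (set_type A)
  rdist_ge0 rdist_positivity ballErdist.

End restricted_metric.

(* The library's measurable types are pointed, whereas a metric space need not
   be, so the Borel sigma-algebra is put on an alias of [T] that carries a
   chosen point [p]. Its measurable sets do not depend on [p]. *)
Definition pointed_at (T : Type) (p : T) : Type := T.

Section pointed_at.
Context {T : topologicalType} (p : T).
HB.instance Definition _ := Choice.copy (pointed_at p) T.
HB.instance Definition _ := isPointed.Build (pointed_at p) p.
End pointed_at.

Definition borel (T : topologicalType) (p : T) :=
  g_sigma_algebraType (@open T : set (set (pointed_at p))).

Section metric_notions.
Context {R : realType}.
Implicit Type T : metricType R.

(* Not the library's [closed_ball], which is the closure of the open ball. *)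
Definition cball T (x : T) (r : R) : set T := [set y | mdist x y <= r].

Definition diam T : \bar R :=
  ereal_sup [set (mdist xy.1 xy.2)%:E | xy in [set: T * T]].

Definition bounded_space T : Prop := (diam T < +oo)%E.

(* As in the library's [completeType], whose [cvg F] needs a base point. *)
Definition complete_space T : Prop :=
  forall F : set_system T, ProperFilter F -> cauchy F ->
    exists l : T, F --> l.

(* [0 < diam T] excludes the empty space (whose [diam] is [-oo]) and one-point
   spaces. *)
Definition ahlfors_regular T (a : R) : Prop :=
  [/\ 0 < a, complete_space T, (0 < diam T)%E &
      exists (p : T) (mu : {measure set (borel p) -> \bar R}) (c C : R),
        0 < c <= C /\
        forall (x : T) (r : R), 0 < r -> (r%:E < diam T)%E ->
          ((c * r `^ a)%:E <= mu (cball x r) <= (C * r `^ a)%:E)%E].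

Definition is_metric (U : Type) (rho : U -> U -> R) : Prop :=
  [/\ forall x y, 0 <= rho x y,
      forall x y, rho x y = 0 <-> x = y,
      forall x y, rho x y = rho y x &
      forall x y z, rho x y <= rho x z + rho z y].

Definition is_ultrametric (U : Type) (rho : U -> U -> R) : Prop :=
  is_metric rho /\
  forall x y z, rho x y <= Num.max (rho x z) (rho y z).

Definition embeds_in_ultrametric T (D : R) : Prop :=
  1 <= D /\
  exists rho : T -> T -> R, is_ultrametric rho /\
    forall x y, mdist x y <= rho x y <= D * mdist x y.

(* [+oo] when [T] embeds in no ultrametric with finite distortion. *)
Definition ultrametric_distortion T : \bar R :=
  ereal_inf [set D%:E | D in embeds_in_ultrametric T].

End metric_notions.

(* Main.v *)
From HB Require Import structures.
Require Import Defs.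
From mathcomp Require Import all_boot all_order all_algebra.
From mathcomp Require Import all_classical all_reals all_analysis.
From mathcomp Require Import ring lra.

(** A Dvoretzky-type theorem for Ahlfors regular spaces: the regular subset is the
    set of leaves of a tree of nested balls, built by repeating one finite
    construction at all scales.

    The finite construction rests on the finite metric Ramsey theorem
    [finite_ramsey]: among [n] points of a metric space, at least
    [n ^ (1 - 1 / m)] embed in an ultrametric with distortion [8 m]. Its proof cuts
    the space along a thin shell, chosen so that the relative loss of points is
    governed by the ratio of the sizes of two concentric balls; those ratios
    telescope along the recursion, so the total loss is only [n ^ (1 / m)].

    In an [alpha]-regular space a ball of radius [r] contains at least a constant
    times [s ^ (- alpha)] points that are [s r]-separated ([exists_separated]).
    Applied to these points with [m] about [2 alpha / (alpha - beta)], the Ramsey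
    theorem leaves [s ^ (- alpha (1 - 1 / m))] of them, up to a constant, and the
    exponent is still greater than [beta]. For a small [s], depending on everything
    including the regularity constants, one can therefore keep exactly [N] points,
    where the contraction [delta = N ^ (- 1 / beta)] is at most [s] divided by the
    distortion ([regular_children]). Around each kept point the construction is
    repeated at the scale [delta r]. The distortion does not deteriorate: two
    leaves are compared at the node where their branches separate, and all
    ultrametric values inside a child stay below those between distinct children,
    so the ultrametrics of the nodes fit together into one ultrametric on the
    leaves, with distortion [16 m = O (alpha / (alpha - beta))]
    ([word_rho_ultra], [word_rho_leaf]).

    Each node at depth [k] has [N] children and [N ^ (- k) = (delta ^ k) ^ beta], so
    the uniform measure on infinite words over [N] letters gives a ball of radius
    [delta ^ k] a measure comparable to its power [beta] ([coded_regular]). That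
    measure is obtained from Lebesgue measure on the unit interval by expansion in
    base [N], and compactness of the leaves comes from that of the space of
    words. *)

Set Implicit Arguments.
Unset Strict Implicit.
Unset Printing Implicit Defensive.

Import Order.TTheory GRing.Theory Num.Theory.

Local Open Scope ring_scope.

(** * Finite metric Ramsey theorem *)

(** If every step grew faster than the [m]-th root of [a m / a 0], the product of
    all [m] growth factors would exceed [a m / a 0]. *)
Lemma exists_slow_growth_step (m : nat) (a : nat -> nat) :
  (0 < m)%N -> (0 < a 0)%N ->
  exists2 i, (i < m)%N & (a i.+1 ^ m * a 0 <= a i ^ m * a m)%N.
Proof.
move=> m0 a0; apply/not_exists2P => H.
have {}H i : (i < m)%N -> (a i ^ m * a m < a i.+1 ^ m * a 0)%N.
  by move=> im; have [//|/negP] := H i; rewrite -ltnNge.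
(* The contrary assumptions, multiplied together up to step [i]. *)
have ind i : (i < m)%N -> (a 0 ^ m * a m ^ i.+1 < a i.+1 ^ m * a 0 ^ i.+1)%N.
  elim: i => [|i IH] im; first by rewrite !expn1 H.
  rewrite [in X in (X < _)%N]expnSr [in X in (_ < X)%N]expnSr mulnA.
  apply: (@leq_ltn_trans (a i.+1 ^ m * a 0 ^ i.+1 * a m)).
    by rewrite leq_mul2r (ltnW (IH (ltnW im))) orbT.
  by rewrite mulnAC [X in (_ < X)%N]mulnCA mulnC ltn_pmul2l ?expn_gt0 ?a0// H.
have := ind m.-1; rewrite prednK// => /(_ (leqnn _)).
by rewrite mulnC ltnn.
Qed.

(** With real roots this reads: [p <= y w] and [q <= z w] give
    [p + q <= (y + z) w], where [w ^ m = M]. Comparing the binomial expansions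
    term by term, after raising to the power [m], stays within the integers. *)
Lemma expn_superadditive (m M p q y z : nat) :
  (p ^ m <= y ^ m * M -> q ^ m <= z ^ m * M ->
   (p + q) ^ m <= (y + z) ^ m * M)%N.
Proof.
case: m => [|m] pM qM; first by move: pM; rewrite !expn0.
rewrite !expnDn big_distrl/=; apply: leq_sum => i _.
rewrite -mulnA leq_mul2l; apply/orP; right.
have im : (i <= m.+1)%N by rewrite -ltnS.
rewrite -(@leq_exp2r _ _ m.+1)//.
apply: (@leq_trans ((y ^ m.+1 * M) ^ (m.+1 - i) * (z ^ m.+1 * M) ^ i)%N).
  rewrite expnMn -!expnM ![(_ * m.+1)%N]mulnC !expnM.
  have mono k u v : (u <= v -> u ^ k <= v ^ k)%N.
    by case: k => // k; rewrite leq_exp2r.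
  by rewrite leq_mul// mono.
rewrite !expnMn mulnACA -expnD subnK// -!expnM.
by rewrite ![(_ * m.+1)%N]mulnC.
Qed.

Section finite_ramsey.
Context {R : realType} (T : finType) (d : T -> T -> R).
Hypothesis d_metric : is_metric d.

(** Positivity of [rho] comes from its lower bound [d]. The bound [Delta] lets two
    such sets be joined by giving the value [Delta] to every mixed pair. *)
Definition ultrametric_on (Y : {set T}) (rho : T -> T -> R) (D Delta : R) :=
  {in Y & Y & Y, forall x y z, rho x y <= Num.max (rho x z) (rho z y)} /\
  {in Y &, forall x y,
    [/\ rho x y = rho y x, d x y <= rho x y <= D * d x y & rho x y <= Delta]}.

Lemma ultrametric_on_setU (A B : {set T}) (rA rB : T -> T -> R) (D Delta : R) :
  [disjoint A & B] ->
  ultrametric_on A rA D Delta -> ultrametric_on B rB D Delta ->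
  {in A & B, forall x y, d x y <= Delta <= D * d x y} ->
  exists rho, ultrametric_on (A :|: B) rho D Delta.
Proof.
move=> dis [uA bA] [uB bB] AB; have [_ _ d_sym _] := d_metric.
have inB x : x \in A -> (x \in B) = false.
  by move=> xA; apply: (disjointFr dis).
have inA x : x \in B -> (x \in A) = false.
  by move=> xB; apply: (disjointFl dis).
exists (fun x y => if (x \in A) && (y \in A) then rA x y else
  if (x \in B) && (y \in B) then rB x y else Delta).
split=> [x y z|x y]; rewrite !inE.
  move=> /orP[] xS /orP[] yS /orP[] zS; rewrite ?xS ?yS ?zS ?(inB _ xS)
    ?(inB _ yS) ?(inB _ zS) ?(inA _ xS) ?(inA _ yS) ?(inA _ zS)//=;
    rewrite ?le_max ?lexx ?orbT//; try by rewrite -le_max ?uA ?uB.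
    by have [_ _ ->] := bA x y xS yS.
  by have [_ _ ->] := bB x y xS yS.
move=> /orP[] xS /orP[] yS; rewrite ?xS ?yS ?(inB _ xS)
    ?(inB _ yS) ?(inA _ xS) ?(inA _ yS)//=; rewrite ?lexx; split => //.
- by have [] := bA x y xS yS.
- by have [] := bA x y xS yS.
- by have [] := bA x y xS yS.
- exact: AB.
- by rewrite d_sym; exact: AB.
- by have [] := bB x y xS yS.
- by have [] := bB x y xS yS.
- by have [] := bB x y xS yS.
Qed.

(** Discard a shell and recurse on its two sides. The centre [x] is the point whose
    ball of radius [Del / 8] is largest, [Del] being the diameter. Between the
    radii [Del / 8] and [Del / 4] there are [m] shells of width [Del / (8 m)], and
    one of them multiplies the size of the ball by a factor whose [m]-th power
    is at most [M / M1], where [M1] is the size of that largest ball.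
    - The inner ball has diameter at most [Del / 2], and all its balls of radius
      [Del / 8] have at most [M1] points, by the choice of [x]. The gain from [M]
      to [M1] pays exactly for the points of the shell.
    - The outside keeps the bound [M].
    Points on different sides are at least [Del / (8 m)] and at most [Del] apart,
    so that the value [Del] costs a distortion of [8 m]. *)
Lemma finite_ramsey_rec (m : nat) (m0 : (0 < m)%N) (n : nat) :
  forall (A : {set T}) (Delta : R) (M : nat), (#|A| <= n)%N ->
    {in A &, forall x y, d x y <= Delta} ->
    {in A, forall x, (#|[set y in A | (d x y <= Delta / 4)%R]| <= M)%N} ->
  exists (Y : {set T}) (rho : T -> T -> R),
    [/\ Y \subset A, (#|A| ^ m <= #|Y| ^ m * M)%N &
        ultrametric_on Y rho (8 * m%:R) Delta].
Proof.
have [d_ge0 d_eq0 d_sym d_tri] := d_metric.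
have dxx x : d x x = 0 by apply/d_eq0.
elim: n => [|n IH] A Delta M.
  rewrite leqn0 cards_eq0 => /eqP-> _ _; exists finset.set0, d; split => //.
    by rewrite cards0 exp0n.
  by split => [x|x] y; rewrite inE.
move=> An diamA ballM.
have [->|[x0 x0A]] := finset.set_0Vmem A.
  exists finset.set0, d; split => //; first by rewrite cards0 exp0n.
  by split => [x|x] y; rewrite inE.
(* The true diameter replaces [Delta], so that the inner ball is a proper subset:
   it cannot contain two points at distance [Del]. *)
pose P := [pred p : T * T | (p.1 \in A) && (p.2 \in A)].
have P0 : P (x0, x0) by rewrite /P/= x0A.
pose pq := [arg max_(p > (x0, x0) | P p) d p.1 p.2]%O.
have [pqA pqmax] : P pq /\ forall p, P p -> d p.1 p.2 <= d pq.1 pq.2.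
  by rewrite /pq; case: arg_maxP => // p Pp H; split.
move: pq pqA pqmax => [a b] /andP[/= aA bA] abmax.
have {}abmax x y : x \in A -> y \in A -> d x y <= d a b.
  by move=> xA yA; apply: (abmax (x, y)); rewrite /P/= xA yA.
have abDelta : d a b <= Delta by exact: diamA.
set Del := d a b in abmax abDelta *.
have [Del0|Del_neq0] := eqVneq Del 0.
  have A1 : A = [set x0].
    apply/finset.setP => y; rewrite inE; apply/idP/eqP => [yA|->//].
    by apply/d_eq0/eqP; rewrite eq_le d_ge0 andbT -Del0 abmax.
  exists A, d; split => //.
    have := ballM x0 x0A; rewrite A1 cards1 exp1n mul1n => /(leq_trans _); apply.
    rewrite card_gt0; apply/finset.set0Pn; exists x0.
    by rewrite !inE eqxx/= dxx divr_ge0// (le_trans _ abDelta)// Del0.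
  rewrite A1; split=> [x y z|x y]; rewrite !inE.
    by move=> /eqP-> /eqP-> /eqP->; rewrite maxxx.
  by move=> /eqP-> /eqP->; rewrite dxx mulr0 lexx; split => //; rewrite -Del0.
have Del_gt0 : 0 < Del by rewrite lt_neqAle eq_sym Del_neq0 d_ge0.
pose B x r := [set y in A | d x y <= r].
have Bsub x r r' : r <= r' -> B x r \subset B x r'.
  move=> rr'; apply/fintype.subsetP => y.
  by rewrite !inE => /andP[-> /le_trans]; exact.
pose x := [arg max_(x > x0 in A) #|B x (Del / 8)|].
have [xA xmax] : x \in A /\
    forall y, y \in A -> (#|B y (Del / 8)| <= #|B x (Del / 8)|)%N.
  by rewrite /x; case: arg_maxnP.
have m_gt0 : 0 < m%:R :> R by rewrite ltr0n.
pose rad (i : nat) : R := Del / 8 + i%:R * (Del / (8 * m%:R)).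
have step_gt0 : 0 < Del / (8 * m%:R) by rewrite divr_gt0// mulr_gt0.
have rad_ge0 i : 0 <= rad i.
  by rewrite addr_ge0// ?mulr_ge0// ?divr_ge0// ?mulr_ge0// ltW.
have xB i : x \in B x (rad i) by rewrite inE xA dxx rad_ge0.
have [|i im /= shell] := @exists_slow_growth_step m (fun i => #|B x (rad i)|) m0.
  by rewrite card_gt0; apply/finset.set0Pn; exists x; exact: xB.
set M1 := #|B x (rad 0)| in shell.
have radm : rad m = Del / 4 by rewrite /rad; field; rewrite lt0r_neq0.
have rad0 : rad 0 = Del / 8 by rewrite /rad mul0r addr0.
have rad_le i' : (i' <= m)%N -> rad i' <= Del / 4.
  by move=> ?; rewrite -radm lerD2l ler_wpM2r ?ler_nat// ltW.
have radS : rad i.+1 = rad i + Del / (8 * m%:R).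
  by rewrite /rad -natr1; ring.
set A0 := B x (rad i) in shell; set A1 := B x (rad i.+1) in shell.
have A0A : A0 \subset A by apply/fintype.subsetP => y; rewrite inE => /andP[].
have A1A : A1 \subset A by apply/fintype.subsetP => y; rewrite inE => /andP[].
have diamA0 : {in A0 &, forall y z, d y z <= Del / 2}.
  move=> y z; rewrite !inE => /andP[_ xy] /andP[_ xz].
  rewrite (le_trans (d_tri _ _ x))// (d_sym y).
  have := rad_le i (ltnW im); lra.
have A0n : (#|A0| <= n)%N.
  rewrite -ltnS (leq_trans _ An)// proper_card// properE A0A/=.
  apply/negP => /fintype.subsetP AA0.
  have := diamA0 _ _ (AA0 _ aA) (AA0 _ bA); rewrite -/Del; lra.
have A2n : (#|A :\: A1| <= n)%N.
  rewrite -ltnS (leq_trans _ An)// proper_card// properE finset.subsetDl/=.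
  by apply/negP => /fintype.subsetP /(_ x xA); rewrite inE xB.
have [Y0 [r0 [Y0A0 cY0 uY0]]] : exists (Y : {set T}) (rho : T -> T -> R),
    [/\ Y \subset A0, (#|A0| ^ m <= #|Y| ^ m * M1)%N &
        ultrametric_on Y rho (8 * m%:R) (Del / 2)].
  apply: IH => // y yA0; have yA := fintype.subsetP A0A _ yA0.
  rewrite /M1 rad0 (leq_trans _ (xmax y yA))// subset_leq_card//.
  apply/fintype.subsetP => z; rewrite !inE => /andP[/andP[-> _]] yz/=.
  by rewrite (le_trans yz)//; lra.
have [Y2 [r2 [Y2A2 cY2 uY2]]] : exists (Y : {set T}) (rho : T -> T -> R),
    [/\ Y \subset A :\: A1, (#|A :\: A1| ^ m <= #|Y| ^ m * M)%N &
        ultrametric_on Y rho (8 * m%:R) Del].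
  apply: IH => // [y z|y]; rewrite !inE.
    by move=> /andP[_ yA] /andP[_ zA]; exact: abmax.
  move=> /andP[_ yA]; rewrite (leq_trans _ (ballM y yA))// subset_leq_card//.
  apply/fintype.subsetP => z; rewrite !inE => /andP[/andP[_ ->]] yz/=.
  by rewrite (le_trans yz)// ler_wpM2r.
have dis : [disjoint Y0 & Y2].
  apply/pred0P => y /=; apply/negP => /andP[/(fintype.subsetP Y0A0) yA0].
  move=> /(fintype.subsetP Y2A2); rewrite inE => /andP[/negP yA1 _].
  apply: yA1; move: y yA0; by apply/fintype.subsetP/Bsub; rewrite radS lerDl ltW.
have [rho [uY bY]] : exists rho, ultrametric_on (Y0 :|: Y2) rho (8 * m%:R) Del.
  apply: (ultrametric_on_setU dis _ uY2).
    case: uY0 => a0 b0; split => [|y z yY zY]; first exact: a0.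
    by have [? ? ?] := b0 _ _ yY zY; split => //; lra.
  move=> y z /(fintype.subsetP Y0A0) yA0 /(fintype.subsetP Y2A2).
  rewrite inE => /andP[zA1 zA].
  rewrite abmax ?(fintype.subsetP A0A _ yA0)//=.
  move: zA1 yA0; rewrite !inE zA/= -ltNge => xz /andP[_ xy].
  rewrite mulrC -ler_pdivrMr ?mulr_gt0//.
  by have := d_tri x z y; lra.
exists (Y0 :|: Y2), rho; split.
- rewrite finset.subUset (fintype.subset_trans Y0A0)//=.
  by rewrite (fintype.subset_trans Y2A2)// finset.subsetDl.
- have -> : #|A| = (#|A1| + #|A :\: A1|)%N.
    by rewrite -(cardsID A1) (finset.setIidPr A1A).
  have -> : #|Y0 :|: Y2| = (#|Y0| + #|Y2|)%N.
    by rewrite cardsU (disjoint_setI0 dis) cards0 subn0.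
  apply: expn_superadditive => //.
  have M1_gt0 : (0 < M1)%N.
    by rewrite card_gt0; apply/finset.set0Pn; exists x; exact: xB.
  rewrite -(leq_pmul2r M1_gt0) (leq_trans shell)//.
  rewrite mulnAC; apply: leq_mul => //.
  rewrite radm (leq_trans _ (ballM x xA))// subset_leq_card//.
  by apply: Bsub; rewrite ler_wpM2r.
- split=> [|y z yY zY]; first exact: uY.
  by have [? ? ?] := bY _ _ yY zY; split => //; exact: le_trans abDelta.
Qed.

(** The nonlinear Dvoretzky theorem for finite metric spaces: a proportion
    [n ^ (- 1 / m)] of [n] points embeds in an ultrametric with distortion [8 m]. *)
Theorem finite_ramsey (m : nat) : (0 < m)%N -> (0 < #|T|)%N ->
  exists (Y : {set T}) (rho : T -> T -> R) (Delta : R),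
    (#|T| ^ m.-1 <= #|Y| ^ m)%N /\ ultrametric_on Y rho (8 * m%:R) Delta.
Proof.
move=> m0 T0; have [d_ge0 d_eq0 d_sym d_tri] := d_metric.
pose Delta := \sum_(p : T * T) d p.1 p.2.
have [|x y _ _|x _|Y [rho [_ cY uY]]] :=
    @finite_ramsey_rec m m0 #|T| finset.setT Delta #|T|.
- by rewrite cardsT.
- rewrite /Delta (bigD1 (x, y))//= lerDl sumr_ge0//.
- exact: max_card.
exists Y, rho, Delta; split=> //.
by move: cY; rewrite cardsT -{1}(prednK m0) expnSr leq_pmul2r.
Qed.

End finite_ramsey.

Local Open Scope classical_set_scope.
Local Open Scope ring_scope.

(** * Separated families in a regular space *)

Section packing.
Context {R : realType} (X : metricType R).

Lemma closed_cball (x : X) (r : R) : closed (cball x r).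
Proof.
rewrite -openC openE => y /= /negP; rewrite -ltNge => ry.
apply/nbhs_ballP; exists (mdist x y - r) => /=; first by rewrite subr_gt0.
move=> z; rewrite ballEmdist/= => yz; apply/negP; rewrite -ltNge.
by have := metric_triangle x z y; rewrite (metric_sym z y); lra.
Qed.

Lemma open_borel (p : X) (U : set X) : open U -> measurable (U : set (borel p)).
Proof. by move=> oU; apply: sub_sigma_algebra. Qed.

Lemma measurable_cball (p x : X) (r : R) :
  measurable (cball x r : set (borel p)).
Proof.
rewrite -(setCK (cball x r)); apply: measurableC; apply: open_borel.
by rewrite openC; exact: closed_cball.
Qed.

Variables (p : X) (mu : {measure set (borel p) -> \bar R}) (a c C : R).
Hypothesis C0 : 0 < C.
Hypothesis mu_reg : forall (x : X) (r : R), 0 < r -> (r%:E < diam X)%E ->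
  ((c * r `^ a)%:E <= mu (cball x r) <= (C * r `^ a)%:E)%E.

(** Greedy choice: as long as at most [n] points are chosen, the balls of radius
    [s r] around them have less measure than the ball of radius [r / 2]. *)
Lemma exists_separated (x : X) (r s : R) (n : nat) :
  0 < s <= 1 -> 0 < r -> (r%:E < diam X)%E ->
  n%:R * s `^ a < c / C * 2^-1 `^ a ->
  exists f : 'I_n.+1 -> X, (forall i, mdist x (f i) <= r / 2) /\
    (forall i j, i != j -> s * r < mdist (f i) (f j)).
Proof.
move=> /andP[s0 s1] r0 rX nsa.
have sr0 : 0 < s * r by rewrite mulr_gt0.
have srX : ((s * r)%:E < diam X)%E.
  by apply: le_lt_trans rX; rewrite lee_fin ger_pMl.
have r2X : ((r / 2)%:E < diam X)%E.
  by apply: le_lt_trans rX; rewrite lee_fin ler_pdivrMr// ler_peMr ?ltW//; lra.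
have cover (g : nat -> X) k : (k <= n)%N ->
    exists y, mdist x y <= r / 2 /\ forall i, (i < k)%N -> s * r < mdist (g i) y.
  move=> kn; apply: contrapT => /forallNP H.
  have sub : cball x (r / 2) `<=` \big[setU/set0]_(i < k) cball (g i) (s * r).
    move=> y xy; rewrite -(bigcup_mkord k (fun i => cball (g i) (s * r))).
    apply: contrapT => ny.
    apply: (H y); split => // i ik; rewrite ltNge; apply/negP => gy.
    by apply: ny; exists i.
  have := content_subadditive mu (fun k _ => @measurable_cball p (g k) (s * r))
    (@measurable_cball p x (r / 2)) sub.
  apply/negP; rewrite -ltNge.
  have /andP[+ _] := mu_reg x (divr_gt0 r0 (ltr0n _ 2)) r2X.
  apply: lt_le_trans.
  apply: (@le_lt_trans _ _ (\sum_(i < k) (C * (s * r) `^ a)%:E)%E).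
    by apply: lee_sum => i _; have /andP[] := mu_reg (g i) sr0 srX.
  rewrite sumEFin lte_fin sumr_const card_ord -[_ *+ k]mulr_natl.
  rewrite !powRM ?(ltW r0) ?(ltW s0)//.
  have ra0 : 0 < r `^ a by exact: powR_gt0.
  rewrite (_ : k%:R * _ = (k%:R * s `^ a) * (C * r `^ a)); last by ring.
  rewrite (_ : c * _ = (c / C * 2^-1 `^ a) * (C * r `^ a)); last first.
    by field; rewrite gt_eqF.
  rewrite ltr_pM2r ?mulr_gt0//; apply: le_lt_trans nsa.
  by rewrite ler_wpM2r ?powR_ge0// ler_nat.
have [g [gx gs]] : exists g : nat -> X,
    (forall i, (i < n.+1)%N -> mdist x (g i) <= r / 2) /\
    forall i j, (i < j < n.+1)%N -> s * r < mdist (g i) (g j).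
  have : (n.+1 <= n.+1)%N by [].
  elim: {1 3 4}n.+1 => [_|k IH kn].
    by exists (fun _ => x); split => // i j; rewrite ltn0 andbF.
  have [g [gx gs]] := IH (ltnW kn).
  have [y [xy gy]] := cover g k kn.
  exists (fun i => if (i < k)%N then g i else y); split.
    by move=> i _; case: ifP => // /gx.
  move=> i j /andP[ij jk]; have ik := leq_trans ij jk.
  rewrite (leq_trans ij)//; case: ifP => jk'; last exact/gy/(leq_trans ij).
  by apply: gs; rewrite ij.
exists (fun i => g i); split => [i|i j]; first exact: gx.
rewrite neq_ltn => /orP[] ij; last rewrite metric_sym; apply: gs;
  by rewrite ij/=.
Qed.

End packing.

(** The parameters of one branching step. The volume bound gives about
    [s ^ (- alpha)] points that are [s r]-separated, of which the Ramsey theorem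
    keeps the power [1 - 1 / m], while [beta]-regularity with contraction
    [N ^ (- 1 / beta) <= s / D] asks for about [(D / s) ^ beta] of them. The
    assumption on [m] gives [alpha (1 - 1 / m) > beta], so a small [s] will do:
    [gam] is [m] times the difference of these two exponents. *)
Lemma exists_branching {R : realType} (alpha beta kappa D : R) (m : nat) :
  0 < beta < alpha -> 0 < kappa -> 2 <= D ->
  2 * alpha <= m%:R * (alpha - beta) ->
  exists (s : R) (N n : nat), [/\ 0 < s <= 1, (1 < N)%N,
    D * N%:R `^ (- beta^-1) <= s, (N ^ m <= n.+1 ^ m.-1)%N &
    n%:R * s `^ alpha < kappa].
Proof.
move=> /andP[b0 ba] k0 D2 mab.
have a0 : 0 < alpha by lra.
have m0 : (0 < m)%N.
  rewrite lt0n; apply/eqP => m0; move: mab; rewrite m0 mul0r; lra.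
have mm : m%:R = m.-1%:R + 1 :> R by rewrite natr1 prednK.
pose gam := alpha * m.-1%:R - beta * m%:R.
have gam0 : 0 < gam by rewrite /gam; move: mab; rewrite mm; lra.
pose A := 2 * D `^ beta.
have D0 : 0 < D by lra.
have A0 : 0 < A by rewrite mulr_gt0// powR_gt0.
pose eta := Num.min 1 ((kappa / 2) ^+ m.-1 / A ^+ m).
have eta0 : 0 < eta by rewrite lt_min ltr01/= divr_gt0// exprn_gt0// divr_gt0.
pose s := eta `^ (gam^-1).
have s0 : 0 < s by rewrite powR_gt0.
have s1 : s <= 1.
  have -> : 1 = 1 `^ gam^-1 :> R by rewrite powR1.
  apply: ge0_ler_powR;
    rewrite ?nnegrE ?invr_ge0 ?(ltW gam0) ?(ltW eta0) ?ler01//.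
  by rewrite /eta ge_min lexx.
have sgam : s `^ gam = eta by rewrite -powRrM mulVf ?lt0r_neq0// powRr1 ?ltW.
pose z := (D / s) `^ beta.
have Ds2 : 2 <= D / s by rewrite ler_pdivlMr//; nra.
have z1 : 1 <= z.
  have -> : 1 = 1 `^ beta :> R by rewrite powR1.
  apply: ge0_ler_powR; rewrite ?nnegrE; lra.
pose N := (Num.truncn z).+1.
have zN : z < N%:R by exact: truncnS_gt.
have Nz : N%:R <= 2 * z.
  have /andP[+ _] : (Num.truncn z)%:R <= z < N%:R by apply: truncn_itv; lra.
  by rewrite /N -natr1; lra.
pose w := kappa / 2 * s `^ (- alpha).
have sa0 : 0 < s `^ alpha by exact: powR_gt0.
have wE : w * s `^ alpha = kappa / 2.
  by rewrite /w -mulrA powRN mulVf ?mulr1// lt0r_neq0.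
have w0 : 0 < w by rewrite mulr_gt0 ?divr_gt0 ?powR_gt0.
pose n := Num.truncn w.
exists s, N, n; split.
- by rewrite s0.
- by rewrite /N ltnS truncn_gt0.
- rewrite powRN -ler_pdivlMr ?invr_gt0 ?powR_gt0 ?ltr0n// invrK.
  rewrite mulrC -ler_pdivrMr//.
  have -> : D / s = z `^ beta^-1.
    by rewrite -powRrM mulfV ?lt0r_neq0// powRr1 ?divr_ge0 ?ltW.
  by apply: ge0_ler_powR; rewrite ?nnegrE ?invr_ge0 ?ler0n ?(ltW b0)
    ?(ltW zN)//; lra.
- rewrite -(ler_nat R) !natrX.
  apply: (@le_trans _ _ ((2 * z) ^+ m)).
    by rewrite lerXn2r ?nnegrE//; lra.
  apply: (@le_trans _ _ (w ^+ m.-1)); last first.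
    by rewrite lerXn2r ?nnegrE ?(ltW w0)// ltW// truncnS_gt.
  have -> : 2 * z = A * s `^ (- beta).
    by rewrite /z powRM ?invr_ge0 ?ltW// -powR_inv1 ?ltW// -powRrM mulN1r mulrA.
  have sX t k : (s `^ t) ^+ k = s `^ (t * k%:R).
    by rewrite -(powR_mulrn k (powR_ge0 s t)) powRrM.
  rewrite /w [(A * _) ^+ _]exprMn [(kappa / 2 * _) ^+ _]exprMn !sX.
  have -> : - beta * m%:R = gam + - alpha * m.-1%:R by rewrite /gam; ring.
  rewrite (powRD (r := gam)); last by rewrite (gt_eqF s0) implybT.
  rewrite mulrA ler_pM2r ?powR_gt0// sgam.
  by rewrite mulrC -ler_pdivlMr ?exprn_gt0// /eta ge_min lexx orbT.
- apply: (@le_lt_trans _ _ (w * s `^ alpha)).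
    rewrite ler_pM2r//.
    by have /andP[] := truncn_itv (ltW w0).
  by rewrite wE; lra.
Qed.

(** One branching step at a node [x] of the tree, at scale [r]. *)
Definition ultra_family {R : realType} (X : metricType R) (N : nat) (s D : R)
    (x : X) (r : R) (f : 'I_N -> X) (rho : 'I_N -> 'I_N -> R) : Prop :=
  [/\ forall i, mdist x (f i) <= r / 2,
      forall i j, i != j -> s * r < mdist (f i) (f j),
      forall i j k, rho i j <= Num.max (rho i k) (rho k j) &
      forall i j, rho i j = rho j i /\
        mdist (f i) (f j) <= rho i j <= D * mdist (f i) (f j)].

(** The same [s] and [N] serve all points and all scales, because the regularity
    constants do; this uniformity is what makes the final measure regular. *)
Lemma regular_children {R : realType} (X : metricType R) (alpha beta : R)
    (m : nat) (p : X) (mu : {measure set (borel p) -> \bar R}) (c C : R) :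
  0 < c -> 0 < C ->
  (forall (x : X) (r : R), 0 < r -> (r%:E < diam X)%E ->
    ((c * r `^ alpha)%:E <= mu (cball x r) <= (C * r `^ alpha)%:E)%E) ->
  0 < beta < alpha -> 2 * alpha <= m%:R * (alpha - beta) ->
  exists (s : R) (N : nat), [/\ 0 < s <= 1, (1 < N)%N,
    8 * m%:R * N%:R `^ (- beta^-1) <= s &
    forall (x : X) (r : R), 0 < r -> (r%:E < diam X)%E ->
      exists f rho, @ultra_family R X N s (8 * m%:R) x r f rho].
Proof.
move=> c0 C0 mu_reg ab mab.
have m0 : (0 < m)%N.
  rewrite lt0n; apply/eqP => m0; move: mab ab; rewrite m0 mul0r; lra.
have D2 : 2 <= 8 * m%:R :> R.
  have : 1%:R <= m%:R :> R by rewrite ler_nat.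
  by lra.
have kap0 : 0 < c / C * 2^-1 `^ alpha by rewrite mulr_gt0 ?divr_gt0 ?powR_gt0.
have [s [N [n [s01 N1 Ns Nn nk]]]] := exists_branching ab kap0 D2 mab.
exists s, N; split => // x r r0 rX.
have [f [fx fsep]] := exists_separated C0 mu_reg x s01 r0 rX nk.
have sr0 : 0 < s * r by case/andP: s01 => s0 _; rewrite mulr_gt0.
have metr : is_metric (fun i j => mdist (f i) (f j)).
  split => [i j|i j|i j|i j k].
  - exact: mdist_ge0.
  - split => [ij|->]; last exact: mdistxx.
    by apply/eqP; apply: contraT => /fsep; rewrite ij ltNge (ltW sr0).
  - exact: metric_sym.
  - exact: metric_triangle.
have [|Y [rho [Delta [cY [uY bY]]]]] := finite_ramsey metr m0.
  by rewrite card_ord.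
have NY : (N <= #|Y|)%N.
  rewrite card_ord in cY.
  by rewrite -(leq_exp2r _ _ m0) (leq_trans Nn).
pose g (i : 'I_N) : 'I_n.+1 := enum_val (widen_ord NY i).
have gY i : g i \in Y by exact: enum_valP.
have g_inj : injective g.
  by move=> i j /enum_val_inj /(congr1 val)/= /val_inj.
exists (f \o g), (fun i j => rho (g i) (g j)); split => [i|i j ij|i j k|i j] /=.
- exact: fx.
- by apply: fsep; rewrite (inj_eq g_inj).
- exact: uY.
- by have [-> ? _] := bY _ _ (gY i) (gY j).
Qed.

(** * The tree of nested balls and its leaves *)

Lemma geometric_small {R : realType} (a b d : R) : 0 < a -> 0 < b < 1 -> 0 < d ->
  exists k, a * b ^+ k < d.
Proof.
move=> a0 /andP[b0 b1] d0; have bn1 : `|b| < 1 by rewrite gtr0_norm.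
have /cvgrPdist_lt/(_ (d / a))[|k _ /(_ k (leqnn k))] := cvg_expr bn1.
  exact: divr_gt0.
rewrite /= sub0r normrN gtr0_norm ?exprn_gt0// ltr_pdivlMr// => dk.
by exists k; rewrite mulrC.
Qed.

Lemma complete_limit {R : realType} (X : metricType R) (u : nat -> X)
    (e : nat -> R) : complete_space X ->
  (forall d, 0 < d -> exists k, e k < d) ->
  (forall k j, mdist (u k) (u (k + j)%N) <= e k) ->
  exists l, forall k, mdist (u k) l <= e k.
Proof.
move=> Xc e0 ue.
have uek k j : (k <= j)%N -> mdist (u k) (u j) <= e k.
  by move=> kj; rewrite -(subnKC kj).
have [|l /metricType_numDomainType.cvgrPdist_lt ul] := Xc (u @ \oo) _.
  apply: cauchy_exP => d d0; have [k ekd] := e0 d d0.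
  exists (u k); exists k => // j /= kj; rewrite ballEmdist/=.
  exact: le_lt_trans (uek _ _ kj) ekd.
exists l => k; apply/ler_addgt0Pl => d d0.
have [j _ ulj] := ul d d0.
have := metric_triangle (u k) (u (maxn k j)) l.
have := ulj (maxn k j) (leq_maxr k j); have := uek _ _ (leq_maxl k j).
by rewrite /= (metric_sym l); lra.
Qed.

Section tree.
Context {R : realType} (X : metricType R) (N : nat).

Local Notation word := (nat -> 'I_N).

Definition agree (k : nat) (w v : word) := forall i, (i < k)%N -> w i = v i.

Definition branch (k : nat) (w v : word) := agree k w v /\ w k <> v k.

Lemma agree_sym k w v : agree k w v -> agree k v w.
Proof. by move=> wv i /wv. Qed.

Lemma agreeS k w v : agree k.+1 w v <-> agree k w v /\ w k = v k.
Proof.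
split=> [wv|[wv wvk] i]; first by split=> [i ik|]; apply: wv => //; exact: ltnW.
by rewrite ltnS leq_eqVlt => /orP[/eqP->//|]; exact: wv.
Qed.

Lemma agree_le j k w v : (j <= k)%N -> agree k w v -> agree j w v.
Proof. by move=> jk wv i ij; apply: wv; exact: leq_trans ij jk. Qed.

Lemma agree_or_branch k w v :
  agree k w v \/ exists2 j, (j < k)%N & branch j w v.
Proof.
elim: k => [|k [IH|[j jk wv]]]; [by left| |by right; exists j => //; exact: ltnW].
have [wvk|wvk] := eqVneq (w k) (v k); first by left; apply/agreeS.
by right; exists k => //; split => //; exact/eqP.
Qed.

Lemma eq_or_branch w v : w = v \/ exists k, branch k w v.
Proof.
have [|/existsNP[k nwv]] := pselect (forall k, agree k w v).
  by move=> wv; left; apply/funext => i; exact: (wv i.+1).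
by right; have [//|[j _ wv]] := agree_or_branch k w v; exists j.
Qed.

Lemma branch_uniq j k w v : branch j w v -> branch k w v -> j = k.
Proof.
by move=> [aj nj] [ak nk]; case: (ltngtP j k) => // [/ak|/aj].
Qed.

Lemma branch_sym k w v : branch k w v -> branch k v w.
Proof. by move=> [/agree_sym ? /nesym ?]. Qed.

Variables (s D delta r0 : R) (p : X).
Variables (child : X -> R -> 'I_N -> X) (urho : X -> R -> 'I_N -> 'I_N -> R).
Hypothesis Xc : complete_space X.
Hypothesis r0_gt0 : 0 < r0.
Hypothesis delta_gt0 : 0 < delta.
Hypothesis D8 : 8 <= D.
Hypothesis Ddelta : D * delta <= s.
Hypothesis s1 : s <= 1.
Hypothesis family : forall (x : X) (r : R), 0 < r <= r0 ->
  ultra_family s D x r (child x r) (urho x r).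

Definition radius (k : nat) := r0 * delta ^+ k.

Lemma delta_le8 : 8 * delta <= s.
Proof. by apply: le_trans Ddelta; rewrite ler_wpM2r// ltW. Qed.

Lemma radius_gt0 k : 0 < radius k. Proof. by rewrite mulr_gt0// exprn_gt0. Qed.

Lemma radiusS k : radius k.+1 = delta * radius k.
Proof. by rewrite /radius exprS; ring. Qed.

Lemma radius_le j k : (j <= k)%N -> radius k <= radius j.
Proof.
elim: k => [|k IH]; first by rewrite leqn0 => /eqP->.
rewrite leq_eqVlt => /orP[/eqP->//|/IH]; apply: le_trans.
have h1 := delta_le8; have h2 := radius_gt0 k.
have h3 := s1; have h4 := delta_gt0.
by rewrite radiusS ler_piMl//; [exact: ltW|lra].
Qed.

Lemma radius_in k : 0 < radius k <= r0.
Proof. by rewrite radius_gt0/= (le_trans (radius_le (leq0n k)))// /radius mulr1. Qed.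

Lemma radius_small e : 0 < e -> exists k, radius k < e.
Proof.
apply: geometric_small => //; rewrite delta_gt0.
by have h1 := delta_le8; have h2 := s1; have h3 := delta_gt0; rewrite /=; lra.
Qed.

Fixpoint node (w : word) (k : nat) : X :=
  if k is j.+1 then child (node w j) (radius j) (w j) else p.

Lemma node_agree k w v : agree k w v -> node w k = node v k.
Proof. by elim: k => //= k IH /agreeS[/IH-> ->]. Qed.

Lemma node_dist w k j : mdist (node w k) (node w (k + j)%N) <= radius k.
Proof.
elim: j k => [|j IH] k; first by rewrite addn0 mdistxx ltW// radius_gt0.
rewrite (le_trans (metric_triangle _ (node w k.+1) _))//.
have := IH k.+1; rewrite addSnnS radiusS.
have [/(_ (w k)) + _ _ _] := family (node w k) (radius_in k).
have h := s1; have := delta_le8; have := radius_gt0 k; rewrite /=; nra.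
Qed.

Lemma word_limit_exists w : exists l, forall k, mdist (node w k) l <= radius k.
Proof. exact: complete_limit radius_small (node_dist w). Qed.

(** The limit of the nodes along the branch of [w]. *)
Definition leaf (w : word) : X := projT1 (cid (word_limit_exists w)).

Lemma leaf_node w k : mdist (node w k) (leaf w) <= radius k.
Proof. exact: (projT2 (cid (word_limit_exists w))). Qed.

Lemma leaf_agree k w v : agree k w v -> mdist (leaf w) (leaf v) <= 2 * radius k.
Proof.
move=> wv; have := metric_triangle (leaf w) (node w k) (leaf v).
rewrite metric_sym {2}(node_agree wv) (metric_sym (leaf w)).
by have := leaf_node w k; have := leaf_node v k; lra.
Qed.

(** When [w] and [v] separate at depth [k], the distance of the two children that
    they pass through; it approximates the distance of the leaves. *)
Definition gap (k : nat) (w v : word) : R :=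
  mdist (child (node w k) (radius k) (w k)) (child (node w k) (radius k) (v k)).

Lemma gap_bounds k w v : branch k w v -> s * radius k < gap k w v <= radius k.
Proof.
move=> [wv wvk]; have [fx fs _ _] := family (node w k) (radius_in k).
rewrite /gap fs/=; last exact/eqP.
have := fx (w k); have := fx (v k).
have := metric_triangle (child (node w k) (radius k) (w k)) (node w k)
  (child (node w k) (radius k) (v k)).
by rewrite (metric_sym _ (node w k)); lra.
Qed.

(** The leaves are within [delta * radius k <= gap k w v / 8] of the children. *)
Lemma leaf_branch k w v : branch k w v ->
  3 / 4 * gap k w v <= mdist (leaf w) (leaf v) <= 5 / 4 * gap k w v.
Proof.
move=> wv; have /andP[g1 _] := gap_bounds wv; case: wv => wv _.
have gapE : gap k w v = mdist (node w k.+1) (node v k.+1).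
  by rewrite /gap /= (node_agree wv).
have := leaf_node w k.+1; have := leaf_node v k.+1.
have h1 := metric_triangle (node w k.+1) (leaf w) (node v k.+1).
have h2 := metric_triangle (leaf w) (leaf v) (node v k.+1).
have h3 := metric_triangle (leaf w) (node w k.+1) (leaf v).
have h4 := metric_triangle (node w k.+1) (node v k.+1) (leaf v).
rewrite (metric_sym (leaf v)) in h2.
rewrite (metric_sym (leaf w) (node w k.+1)) in h3.
have : 8 * (delta * radius k) <= gap k w v.
  apply: le_trans (ltW g1); rewrite mulrA ler_wpM2r ?delta_le8// ltW//.
  exact: radius_gt0.
rewrite -radiusS -gapE in h1 h4 *; lra.
Qed.

Lemma leaf_agree_of_close k w v : mdist (leaf w) (leaf v) <= 2 * radius k ->
  agree k w v.
Proof.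
move=> wv; have [//|[j jk b]] := agree_or_branch k w v.
have := leaf_branch b; have := gap_bounds b; have := radius_le jk.
rewrite radiusS => h1 /andP[h2 _] /andP[h3 _].
have : 8 * delta * radius j <= s * radius j.
  by rewrite ler_wpM2r ?delta_le8// ltW// radius_gt0.
have := radius_gt0 j; have := radius_gt0 k; lra.
Qed.

(** Two words are compared by the finite ultrametric of the node where they
    separate. *)
Definition word_rho (w v : word) : R :=
  if pselect (exists k, branch k w v) is left wv then
    let k := projT1 (cid wv) in urho (node w k) (radius k) (w k) (v k)
  else 0.

Lemma word_rhoE k w v : branch k w v ->
  word_rho w v = urho (node w k) (radius k) (w k) (v k).
Proof.
rewrite /word_rho => wv; case: pselect => [H|[]]; last by exists k.
by case: cid => j /= /branch_uniq/(_ wv) ->.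
Qed.

Lemma word_rhoxx w : word_rho w w = 0.
Proof. by rewrite /word_rho; case: pselect => // -[k []]. Qed.

Lemma word_rho_sym w v : word_rho w v = word_rho v w.
Proof.
have [->//|[k b]] := eq_or_branch w v.
rewrite (word_rhoE b) (word_rhoE (branch_sym b)) -(node_agree b.1).
by have [_ _ _ /(_ (w k) (v k))[]] := family (node w k) (radius_in k).
Qed.

Lemma word_rho_gap k w v : branch k w v ->
  gap k w v <= word_rho w v <= D * gap k w v.
Proof.
move=> b; rewrite (word_rhoE b).
by have [_ _ _ /(_ (w k) (v k))[]] := family (node w k) (radius_in k).
Qed.

Lemma word_rho_ge0 w v : 0 <= word_rho w v.
Proof.
have [->|[k b]] := eq_or_branch w v; first by rewrite word_rhoxx.
have /andP[+ _] := word_rho_gap b; apply: le_trans; exact: mdist_ge0.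
Qed.

(** If [w] leaves [v] before it leaves [u], then [word_rho w v] belongs to a
    coarser scale and dominates, because [D * delta <= s] makes every value at
    depth [k.+1] at most every value at depth [k]. If later, then [v] and [u]
    separate exactly where [w] and [u] do. At equal depth the finite ultrametric
    inequality of the common node applies. *)
Lemma word_rho_ultra w v u :
  word_rho w u <= Num.max (word_rho w v) (word_rho v u).
Proof.
have [<-|[k1 b1]] := eq_or_branch w v; first by rewrite le_max lexx orbT.
have [->|[k b]] := eq_or_branch w u.
  by rewrite word_rhoxx le_max word_rho_ge0.
have [k1k|kk1|kk1] := ltngtP k1 k.
- rewrite le_max; apply/orP; left.
  have /andP[+ _] := word_rho_gap b1; apply: le_trans.
  have /andP[_ +] := word_rho_gap b; move=> /le_trans; apply.
  have /andP[+ _] := gap_bounds b1; move=> /ltW; apply: le_trans.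
  have /andP[_ gk] := gap_bounds b.
  have Dgt0 : 0 < D by exact: lt_le_trans D8.
  rewrite (@le_trans _ _ (D * (delta * radius k1)))//.
    by rewrite ler_pM2l// (le_trans gk)// -radiusS; exact: radius_le.
  by rewrite mulrA ler_pM2r// radius_gt0.
- have b2 : branch k v u.
    split; first by move=> i ik; rewrite -(b.1 i ik) b1.1// (ltn_trans ik).
    by rewrite -(b1.1 k kk1); exact: b.2.
  rewrite le_max (word_rhoE b2) (word_rhoE b) (b1.1 k kk1).
  by rewrite (node_agree (agree_le (ltnW kk1) b1.1)) lexx orbT.
- rewrite kk1 in b1; rewrite (word_rhoE b) (word_rhoE b1).
  have [vu|vu] := eqVneq (v k) (u k); first by rewrite vu le_max lexx.
  have b2 : branch k v u.
    by split; [move=> i ik; rewrite -b.1// b1.1|exact/eqP].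
  rewrite (word_rhoE b2) -(node_agree b1.1).
  by have [_ _ + _] := family (node w k) (radius_in k); exact.
Qed.

Lemma word_rho_leaf w v :
  mdist (leaf w) (leaf v) <= 5 / 4 * word_rho w v
    <= 2 * D * mdist (leaf w) (leaf v).
Proof.
have [->|[k b]] := eq_or_branch w v.
  by rewrite word_rhoxx mdistxx !mulr0 lexx.
have := word_rho_gap b; have := leaf_branch b; have := gap_bounds b.
move=> /andP[g1 g2] /andP[h1 h2] /andP[k1 k2].
have : 0 < gap k w v.
  apply: lt_trans g1; rewrite mulr_gt0 ?radius_gt0//.
  by have := delta_le8; have := delta_gt0; lra.
have := D8; move=> D8' g0; apply/andP; split; [lra|nra].
Qed.

End tree.

(** * Compactness and the coded measure *)

Lemma compact_complete_space {R : realType} (T : metricType R) :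
  compact [set: T] -> complete_space T.
Proof.
move=> cT F FF /cauchyP Fc; have [l [_ Fl]] := cT F FF filterT.
exists l; apply/metricType_numDomainType.fcvgrPdist_lt => e e0.
have e4 : 0 < e / 4 by rewrite divr_gt0.
have [x Fx] := Fc _ e4.
have [z [xz lz]] := Fl _ _ Fx (nbhsx_ballx l _ e4).
apply: filterS Fx => y; move: xz lz; rewrite !ballEmdist /= => xz lz xy.
have := metric_triangle l z y; have := metric_triangle z x y.
rewrite (metric_sym z x); lra.
Qed.

Lemma pushforward_measureP {d d' : measure_display} {T1 : measurableType d}
    {T2 : measurableType d'} {R : realType} (m : {measure set T1 -> \bar R})
    (f : T1 -> T2) : measurable_fun setT f ->
  exists nu : {measure set T2 -> \bar R}, forall A, nu A = m (f @^-1` A).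
Proof.
move=> mf.
by unshelve eexists (pushforward m f : {measure set T2 -> \bar R}).
Qed.

Section words.
Context {R : realType} (N : nat).
Local Notation word := (nat -> 'I_N).

Definition word_space := prod_topology (fun _ : nat => discrete_topology 'I_N).
HB.instance Definition _ := Topological.on word_space.

Lemma compact_word_space : compact [set: word_space].
Proof.
have fin : compact [set: discrete_topology 'I_N].
  by apply: finite_compact; exact: (@finite_finset 'I_N setT).
have := @tychonoff _ (fun _ : nat => discrete_topology 'I_N) _ (fun=> fin).
by congr (compact _); rewrite eqEsubset.
Qed.

Lemma nbhs_agree (w : word_space) (k : nat) : nbhs w [set v | agree k w v].
Proof.
elim: k => [|k IH]; first by apply: filterS filterT.
have wk : nbhs w [set v : word_space | v k = w k].
  exact: (@proj_continuous _ (fun=> discrete_topology 'I_N) k w _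
    (discrete_set1 _)).
by apply: filterS (filterI IH wk) => v [wv ?]; apply/agreeS.
Qed.

Lemma continuous_words (T : metricType R) (q : word -> T) (e : nat -> R) :
  (forall d, 0 < d -> exists k, e k < d) ->
  (forall k w v, agree k w v -> mdist (q w) (q v) <= e k) ->
  continuous (q : word_space -> T).
Proof.
move=> e0 qe w U /nbhs_ballP[d /= d0 dU]; have [k ekd] := e0 d d0.
apply: filterS (nbhs_agree w k) => v wv; apply: dU.
by rewrite ballEmdist/=; exact: le_lt_trans (qe k w v wv) ekd.
Qed.

End words.

Section digits.
Context {R : realType} (N : nat) (N0 : (0 < N)%N).
Local Notation word := (nat -> 'I_N).

(** The integer whose base-[N] expansion consists of the first [k] digits of [t],
    for [t] in the unit interval. *)
Definition level (k : nat) (t : R) : nat := Num.truncn (t * N%:R ^+ k).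

Definition digits (t : R) : word :=
  fun i => Ordinal (ltn_pmod (level i.+1 t) N0).

Lemma truncn_neg (x : R) : x < 0 -> Num.truncn x = 0%N.
Proof.
move=> x0; apply/eqP; rewrite -leqn0 leqNgt truncn_gt0 -ltNge.
exact: lt_trans x0 ltr01.
Qed.

Lemma truncn_mulnK (x : R) : (Num.truncn (x * N%:R) %/ N)%N = Num.truncn x.
Proof.
have Npos : 0 < N%:R :> R by rewrite ltr0n.
have [x0|x0] := ltP x 0.
  by rewrite !truncn_neg ?div0n// pmulr_llt0.
apply/esym/truncn_def.
set j := Num.truncn _; have /andP[j1 j2] : j%:R <= x * N%:R < j.+1%:R.
  by apply: truncn_itv; rewrite mulr_ge0// ltW.
apply/andP; split.
  rewrite -(ler_pM2r Npos) -natrM; apply: le_trans j1.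
  by rewrite ler_nat leq_divM.
rewrite -(ltr_pM2r Npos) -natrM; apply: lt_le_trans j2 _.
by rewrite ler_nat ltn_ceil.
Qed.

Lemma level_divn k t : (level k.+1 t %/ N)%N = level k t.
Proof. by rewrite /level exprSr mulrA truncn_mulnK. Qed.

Lemma agree_digits k t u :
  level k t = level k u -> agree k (digits t) (digits u).
Proof.
elim: k => [//|k IH] tu; apply/agreeS; split.
  by apply: IH; rewrite -(level_divn k t) -(level_divn k u) tu.
by apply: val_inj; rewrite /= tu.
Qed.

Fixpoint prefix_index (w : word) (k : nat) : nat :=
  if k is j.+1 then (prefix_index w j * N + w j)%N else 0%N.

Lemma prefix_index_lt w k : (prefix_index w k < N ^ k)%N.
Proof.
elim: k => [|k IH]; first by rewrite expn0.
rewrite expnSr (@leq_trans ((prefix_index w k).+1 * N))//; last first.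
  by rewrite leq_mul2r IH orbT.
by rewrite mulSnr /= ltn_add2l.
Qed.

Lemma agree_digitsP k w t : 0 <= t < 1 ->
  agree k w (digits t) <-> level k t = prefix_index w k.
Proof.
move=> t01; elim: k => [|k IH].
  split=> // _; rewrite /level expr0 mulr1; exact: truncn_def.
rewrite agreeS IH; split=> [[lk wk]|lk].
  by rewrite (divn_eq (level k.+1 t) N) level_divn lk /= wk.
split; first by rewrite -level_divn lk /= divnMDl// divn_small// addn0.
by apply: val_inj; rewrite /= lk /= modnMDl modn_small.
Qed.

Lemma measurable_level k j :
  measurable ([set t | level k t = j] : set (measurableTypeR R)).
Proof.
have Nk : 0 < N%:R ^+ k :> R by rewrite exprn_gt0// ltr0n.
have mL n :
    measurable ([set t | t * N%:R ^+ k < n%:R] : set (measurableTypeR R)).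
  rewrite (_ : [set _ | _] = `]-oo, (n%:R / N%:R ^+ k)[%classic).
    exact: measurable_itv.
  by apply/seteqP; split=> t /=; rewrite in_itv/= ltr_pdivlMr.
case: j => [|j].
  rewrite (_ : [set _ | _] = [set t | t * N%:R ^+ k < 1%:R])//.
  apply/seteqP; split=> t /=; rewrite -truncn_le_nat leqn0;
    by move=> /eqP.
rewrite (_ : [set _ | _] =
  [set t | t * N%:R ^+ k < j.+2%:R] `\` [set t | t * N%:R ^+ k < j.+1%:R]).
  exact: measurableD.
apply/seteqP; split=> t /=; rewrite -!truncn_le_nat -/(level k t).
  by move=> ->; split => //; rewrite ltnn.
by move=> [h1 /negP]; rewrite -ltnNge => h2; apply/eqP; rewrite eqn_leq h1.
Qed.

(** The numbers whose first [k] digits are prescribed form an [N]-adic interval, so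
    that Lebesgue measure turns into the uniform Bernoulli measure on words. *)
Lemma cylinderE k w : [set t | agree k w (digits t)] `&` `[0, 1[ =
  `[(prefix_index w k)%:R / N%:R ^+ k,
    (prefix_index w k).+1%:R / N%:R ^+ k[%classic.
Proof.
have Nk : 0 < N%:R ^+ k :> R by rewrite exprn_gt0// ltr0n.
apply/seteqP; split=> t /=; rewrite !in_itv/= ler_pdivrMr// ltr_pdivlMr//.
  move=> [wt t01]; have /(agree_digitsP _ _ t01) <- := wt.
  by apply: truncn_itv; rewrite mulr_ge0 ?(ltW Nk)//; case/andP: t01.
move=> t1; have t01 : 0 <= t < 1.
  case/andP: t1 => t1 t2; apply/andP; split.
    by rewrite -(pmulr_lge0 _ Nk); apply: le_trans t1; rewrite ler0n.
  rewrite -(ltr_pM2r Nk) mul1r; apply: lt_le_trans t2 _.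
  by rewrite -natrX ler_nat prefix_index_lt.
by split => //; apply/agree_digitsP => //; exact: truncn_def.
Qed.

Lemma measurable_cylinder k w : measurable
  ([set t | agree k w (digits t)] `&` `[0, 1[ : set (measurableTypeR R)).
Proof. by rewrite cylinderE; exact: measurable_itv. Qed.

Lemma lebesgue_measure_cylinder k w :
  lebesgue_measure
    ([set t | agree k w (digits t)] `&` `[0, 1[ : set (measurableTypeR R))
  = (N%:R ^- k)%:E.
Proof.
have Nk : 0 < N%:R ^+ k :> R by rewrite exprn_gt0// ltr0n.
rewrite cylinderE lebesgue_measure_itv/= lte_fin ltr_pM2r ?invr_gt0//.
rewrite ltr_nat ltnS leqnn.
by rewrite -EFinD -mulrBl -natr1 addrAC subrr add0r mul1r.
Qed.

End digits.

Section coding.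
Context {R : realType} (N : nat) (N1 : (1 < N)%N).
Local Notation word := (nat -> 'I_N).
Variables (T : metricType R) (q : word -> T) (e0 delta beta : R).
Hypothesis q_surj : forall x, exists w, q w = x.
Hypothesis e0_gt0 : 0 < e0.
Hypothesis delta01 : 0 < delta < 1.
Hypothesis beta_gt0 : 0 < beta.
Hypothesis deltaN : delta `^ beta = N%:R^-1.
Hypothesis q_agree : forall k w v,
  agree k w v <-> mdist (q w) (q v) <= e0 * delta ^+ k.

Let N0 : (0 < N)%N. Proof. exact: ltnW. Qed.
Let e k := e0 * delta ^+ k.
Let delta_gt0 : 0 < delta. Proof. by case/andP: delta01. Qed.
Let e_gt0 k : 0 < e k. Proof. by rewrite mulr_gt0// exprn_gt0. Qed.

Let e_small d : 0 < d -> exists k, e k < d.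
Proof. exact: geometric_small. Qed.

Lemma compact_coded : compact [set: T].
Proof.
rewrite (_ : [set: T] = (q : word_space N -> T) @` setT); last first.
  by apply/seteqP; split => // x _; have [w <-] := q_surj x; exists w.
apply: continuous_compact; last exact: compact_word_space.
apply/continuous_subspaceT/(continuous_words e_small).
by move=> k w v /q_agree.
Qed.

Let coding_map (p : T) : measurableTypeR R -> borel p := fun t => q (digits N0 t).

(** The preimage of an open set [U] is the union, over all [k], of the sets of [t]
    whose first [k] digits already force the coded point into [U]. *)
Lemma measurable_coding_map (p : T) : measurable_fun setT (@coding_map p).
Proof.
apply: (@measurability _ _ (measurableTypeR R) (borel p) setT _
  (@open T : set (set (borel p)))) => //.
move=> _ [U oU <-]; rewrite setTI.
pose G k := [set j | exists t : R, level N k t = j /\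
  forall v, agree k (digits N0 t) v -> U (q v)].
rewrite (_ : _ @^-1` _ =
  \bigcup_k \bigcup_(j in G k) [set t | level N k t = j]).
  apply: bigcup_measurable => k _; apply: bigcup_measurable => j _.
  exact: measurable_level.
apply/seteqP; split => [t Ut|t [k _ [j [u [uj uU]] tj]]].
  have /nbhs_ballP[d /= d0 dU] := open_nbhs_nbhs (conj oU Ut).
  have [k ekd] := e_small d0; exists k => //; exists (level N k t) => //.
  exists t; split => // v /q_agree tv; apply: dU.
  by rewrite ballEmdist/=; exact: le_lt_trans tv ekd.
by apply: uU; apply: agree_digits; rewrite uj tj.
Qed.

Lemma diam_coded : (0 < diam T)%E /\ (diam T <= e0%:E)%E.
Proof.
split; last first.
  apply: ge_ereal_sup => _ [[x y] _ <-] /=; rewrite lee_fin.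
  have [w <-] := q_surj x; have [v <-] := q_surj y.
  by rewrite -[leRHS]mulr1; apply/(q_agree 0).
pose w : word := fun _ => Ordinal N0; pose v : word := fun _ => Ordinal N1.
apply: (@lt_le_trans _ _ (mdist (q w) (q v))%:E).
  rewrite lte_fin lt_neqAle mdist_ge0 andbT; apply/eqP => wv.
  have /q_agree/(_ 0%N isT)/(congr1 val) // : mdist (q w) (q v) <= e 1.
  by rewrite -wv ltW.
by apply: ereal_sup_ubound; exists (q w, q v).
Qed.

(** Balls of radius about [e k] are cylinders of depth about [k], whose measure
    [N ^ (- k)] is the power [beta] of [delta ^ k]. *)
Lemma coded_regular : ahlfors_regular T beta.
Proof.
have [diam0 diam_le] := diam_coded.
split => //; first exact/compact_complete_space/compact_coded.
pose p := q (fun _ => Ordinal N0).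
have mD : measurable (`[0, 1[%classic : set (measurableTypeR R)).
  exact: measurable_itv.
have [nu nuE] := pushforward_measureP (mrestr lebesgue_measure mD)
  (@measurable_coding_map p).
have mball x r : measurable
    (@coding_map p @^-1` (cball x r) `&` `[0, 1[ : set (measurableTypeR R)).
  apply: measurableI => //; rewrite -[X in measurable X]setTI.
  by apply: measurable_coding_map => //; exact: measurable_cball.
have lower k w r : e k <= r -> ((N%:R ^- k)%:E <= nu (cball (q w) r))%E.
  move=> ekr; rewrite nuE /mrestr -(lebesgue_measure_cylinder N0 k w).
  apply: le_measure; rewrite ?inE; [exact: measurable_cylinder|exact: mball|].
  move=> t [/= wt t01]; split => //.
  by apply: le_trans ekr; apply/q_agree.
have upper k w r : r <= e k -> (nu (cball (q w) r) <= (N%:R ^- k)%:E)%E.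
  move=> ekr; rewrite nuE /mrestr -(lebesgue_measure_cylinder N0 k w).
  apply: (@le_measure _ _ _ lebesgue_measure); rewrite ?inE;
    [exact: mball|exact: measurable_cylinder|].
  move=> t [/= wt t01]; split => //=.
  by apply/q_agree; exact: le_trans ekr.
have Npos : 0 < N%:R :> R by rewrite ltr0n.
have eE k : e k `^ beta = e0 `^ beta * N%:R ^- k.
  rewrite /e powRM ?(ltW e0_gt0) ?exprn_ge0 ?ltW//; congr (_ * _).
  elim: k => [|k IH]; first by rewrite !expr0 powR1 invr1.
  by rewrite !exprS powRM ?exprn_ge0 ?(ltW delta_gt0)// deltaN IH invfM.
have e0b : 0 < e0 `^ beta by exact: powR_gt0.
have mono x y : 0 <= x -> x <= y -> x `^ beta <= y `^ beta.
  move=> x0 xy; apply: ge0_ler_powR; rewrite ?nnegrE ?(ltW beta_gt0)//.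
  exact: le_trans xy.
exists p, nu, ((e0 `^ beta * N%:R)^-1), (N%:R / e0 `^ beta); split.
  rewrite invr_gt0 mulr_gt0//= invfM mulrC ler_pM2r ?invr_gt0//.
  rewrite (@le_trans _ _ 1)// ?invf_le1// ?ler1n//.
move=> x r r0 rT; have [w wx] := q_surj x.
have [k [ekr rek]] : exists k, e k.+1 <= r /\ r <= e k.
  have r1 : r <= e 0 by rewrite /e expr0 mulr1 -lee_fin (le_trans (ltW rT)).
  have [k ekr] := e_small r0.
  have {ekr} : e k.+1 <= r.
    apply: le_trans (ltW ekr); rewrite /e exprS mulrCA ler_piMl ?(ltW (e_gt0 k))//.
    by case/andP: delta01 => _ /ltW.
  elim: k => [ek|k IH ek]; first by exists 0%N.
  by have [rk|rk] := leP r (e k.+1); [exists k.+1|apply/IH/ltW].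
rewrite -wx; apply/andP; split.
  apply: le_trans (lower _ w _ ekr); rewrite lee_fin mulrC ler_pdivrMr ?mulr_gt0//.
  have -> : N%:R ^- k.+1 * (e0 `^ beta * N%:R) = e0 `^ beta * N%:R ^- k.
    by rewrite exprS; field; rewrite expf_neq0 lt0r_neq0.
  by rewrite -eE; exact/mono/rek/ltW.
apply: (le_trans (upper _ w _ rek)); rewrite lee_fin mulrAC ler_pdivlMr//.
have -> : N%:R ^- k * e0 `^ beta = N%:R * (e0 `^ beta * N%:R ^- k.+1).
  by rewrite exprS; field; rewrite expf_neq0 lt0r_neq0.
by rewrite ler_pM2l// -eE; exact/mono/ekr/ltW.
Qed.

End coding.

(** * The regular subset *)

(** The leaves of the tree form a copy of the space of words, in which sharing [k]
    letters amounts to being at distance at most [2 * r0 * delta ^+ k]. *)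
Lemma exists_word_embedding {R : realType} (X : metricType R) (N : nat)
    (s D delta r0 : R) (p : X) :
  complete_space X -> 0 < r0 -> 0 < delta -> 8 <= D -> D * delta <= s ->
  s <= 1 ->
  (forall (x : X) (r : R), 0 < r <= r0 ->
    exists f rho, @ultra_family R X N s D x r f rho) ->
  exists (q : (nat -> 'I_N) -> X) (rho : (nat -> 'I_N) -> (nat -> 'I_N) -> R),
    [/\ forall k w v, agree k w v <-> mdist (q w) (q v) <= 2 * r0 * delta ^+ k,
        forall w v u, rho w u <= Num.max (rho w v) (rho v u),
        forall w v, rho w v = rho v w &
        forall w v, mdist (q w) (q v) <= rho w v <= 2 * D * mdist (q w) (q v)].
Proof.
move=> Xc r0_gt0 delta_gt0 D8 Ddelta s1 family.
have /choice[g gE] (xr : X * R) :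
    exists fr : ('I_N -> X) * ('I_N -> 'I_N -> R),
      0 < xr.2 <= r0 -> ultra_family s D xr.1 xr.2 fr.1 fr.2.
  have [/(family xr.1)[f [rho frho]]|] := boolP (0 < xr.2 <= r0).
    by exists (f, rho).
  by exists (fun=> p, fun _ _ => 0).
pose child x r := (g (x, r)).1; pose urho x r := (g (x, r)).2.
have fam (x : X) (r : R) : 0 < r <= r0 ->
    ultra_family s D x r (child x r) (urho x r) by exact: (gE (x, r)).
pose q := leaf p Xc r0_gt0 delta_gt0 D8 Ddelta s1 fam.
pose rho w v := 5 / 4 * word_rho delta r0 p child urho w v.
exists q, rho; split => [k w v|w v u|w v|w v].
- by rewrite -mulrA; split; [exact: leaf_agree|exact: leaf_agree_of_close].
- rewrite /rho -maxr_pMr// ler_pM2l//.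
  exact: (word_rho_ultra p r0_gt0 delta_gt0 D8 Ddelta s1 fam).
- by rewrite /rho (word_rho_sym p r0_gt0 delta_gt0 D8 Ddelta s1 fam).
- exact: word_rho_leaf.
Qed.

Lemma ultrametric_distortion_le {R : realType} (T : metricType R) (D : R)
    (rho : T -> T -> R) : 1 <= D ->
  (forall x y z, rho x y <= Num.max (rho x z) (rho z y)) ->
  (forall x y, rho x y = rho y x) ->
  (forall x y, mdist x y <= rho x y <= D * mdist x y) ->
  (ultrametric_distortion T <= D%:E)%E.
Proof.
move=> D1 ultra sym bnd; apply: ereal_inf_lbound; exists D => //; split=> //.
have ge0 x y : 0 <= rho x y.
  by have /andP[+ _] := bnd x y; apply: le_trans; exact: mdist_ge0.
exists rho; split; last exact: bnd.
split; last by move=> x y z; rewrite (sym y z); exact: ultra.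
split => // [x y|x y z].
  split=> [xy|->].
    apply: mdist_positivity; apply/eqP; rewrite eq_le mdist_ge0 andbT -xy.
    by have /andP[] := bnd x y.
  apply/eqP; rewrite eq_le ge0 andbT.
  by have /andP[_] := bnd y y; rewrite mdistxx mulr0.
by rewrite (le_trans (ultra x y z))// ge_max lerDl lerDr !ge0.
Qed.

Theorem theorem1p1 (R : realType) :
  exists K : R, 0 < K /\
    forall (alpha beta : R) (X : metricType R),
      0 < beta -> beta < alpha ->
      bounded_space X -> ahlfors_regular X alpha ->
      exists Y : set X,
        [/\ compact Y,
            ahlfors_regular (set_type Y) beta &
            (ultrametric_distortion (set_type Y)
               <= (K * (alpha / (alpha - beta)))%:E)%E].
Proof.
exists 48; split => // alpha beta X b0 ba bX [a0 Xc diam0].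
move=> [p [mu [c [C [/andP[c0 cC] mu_reg]]]]].
have C0 : 0 < C by exact: lt_le_trans cC.
have ab0 : 0 < alpha - beta by rewrite subr_gt0.
(* [m] is just above [2 z], hence at most [3 z]; the tree has distortion [16 m],
   which accounts for the constant [48]. *)
pose z := alpha / (alpha - beta).
have zE : z * (alpha - beta) = alpha by rewrite /z mulfVK ?lt0r_neq0.
have z1 : 1 <= z by rewrite /z ler_pdivlMr// mul1r; lra.
pose m := (Num.truncn (2 * z)).+1.
have mz : 2 * z < m%:R by exact: truncnS_gt.
have zm : m%:R <= 3 * z.
  have /andP[+ _] : (Num.truncn (2 * z))%:R <= 2 * z < m%:R.
    by apply: truncn_itv; lra.
  by rewrite /m -natr1; lra.
have mab : 2 * alpha <= m%:R * (alpha - beta).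
  by rewrite -[X in 2 * X <= _]zE mulrA ler_pM2r// ltW.
have b0a : 0 < beta < alpha by rewrite b0.
have [s [N [/andP[s0 s1] N1 Ds children]]] :=
  regular_children c0 C0 mu_reg b0a mab.
set delta := N%:R `^ (- beta^-1) in Ds.
have Npos : 0 < N%:R :> R by rewrite ltr0n ltnW.
have delta0 : 0 < delta by exact: powR_gt0.
have D8 : 8 <= 8 * m%:R :> R by rewrite ler_peMr// ler1n.
have deltaN : delta `^ beta = N%:R^-1.
  by rewrite /delta -powRrM mulNr mulVf ?lt0r_neq0// powR_inv1// ltW.
have [d dE] : exists d : R, diam X = d%:E.
  by move: bX diam0; rewrite /bounded_space; case: (diam X) => // d _ _; exists d.
have d0 : 0 < d by rewrite -lte_fin -dE.
have r0_gt0 : 0 < d / 2 by rewrite divr_gt0.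
have children' (x : X) (r : R) : 0 < r <= d / 2 ->
    exists f rho, @ultra_family R X N s (8 * m%:R) x r f rho.
  move=> /andP[r0 rd]; apply: children => //.
  by rewrite dE lte_fin; lra.
have [q [rho [q_agree ultra sym bnd]]] :=
  exists_word_embedding p Xc r0_gt0 delta0 D8 Ds s1 children'.
pose Y := range q.
pose q' w : set_type Y := SigSub (mem_set (imageT q w)).
have q'_surj y : exists w, q' w = y.
  have [w _ wy] := set_valP y; exists w.
  by apply: val_inj.
have d01 : 0 < delta < 1.
  by rewrite delta0/=; nra.
have e0 : 0 < 2 * (d / 2) by lra.
exists Y; split.
- have cY : compact [set: set_type Y].
    exact: (compact_coded q'_surj e0 d01 q_agree).
  rewrite (_ : Y = set_val @` [set: set_type Y]).
    apply: continuous_compact => //; apply: continuous_subspaceT.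
    exact: initial_continuous.
  by apply/seteqP; split => [_ [w _ <-]|_ [y _ <-]]; [exists (q' w)|exact: set_valP].
- exact: (coded_regular N1 q'_surj e0 d01 b0 deltaN q_agree).
- have /choice[code codeE] := q'_surj.
  apply: (@le_trans _ _ (2 * (8 * m%:R))%:E); last first.
    by rewrite lee_fin -/z; lra.
  apply: (ultrametric_distortion_le (rho := fun x y => rho (code x) (code y))).
  + lra.
  + by move=> x y u; exact: ultra.
  + by move=> x y; exact: sym.
  + move=> x y; rewrite (_ : mdist x y = mdist (q (code x)) (q (code y))).
      exact: bnd.
    by rewrite -{1}(codeE x) -{1}(codeE y).
Qed.
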